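(* Let $\mathrm{ZX}_{\mathsf{simp}}$ be the simplified stabilizer ZX-calculus described in the context. Let (B2$'$) be the bialgebra rule $$R_Z^{(0,0)}\otimes\big[(R_X^{(2,1)}\otimes R_X^{(2,1)})\circ(1_1\otimes\sigma\otimes1_1)\circ(R_Z^{(1,2)}\otimes R_Z^{(1,2)})\big]=(R_Z^{(1,0)}\circ R_X^{(0,1)})\otimes(R_Z^{(1,2)}\circ R_X^{(2,1)})$$ and (S3$'$R) the rule $R_Z^{(0,2)}=R_X^{(0,2)}$ (all angles $0$). Then at least one of these two rules is necessary, in the sense that $$\mathrm{ZX}_{\mathsf{simp}}\setminus\{(\mathrm{B2'}),(\mathrm{S3'R})\}\not\vdash(\mathrm{B2'})\qquad\text{and}\qquad\mathrm{ZX}_{\mathsf{simp}}\setminus\{(\mathrm{B2'}),(\mathrm{S3'R})\}\not\vdash(\mathrm{S3'R}).$$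
   Context: **Diagrams.** Diagrams $D:n\to m$ ($n,m\in\mathbb N$) are the morphisms of the free strict monoidal category with objects $\mathbb N$ (tensor on objects is addition) generated by: green spiders $R_Z^{(n,m)}(\alpha):n\to m$ and red spiders $R_X^{(n,m)}(\alpha):n\to m$ for all $n,m\in\mathbb N$ and $\alpha\in\{k\pi/2\mid k\in\mathbb Z\}$ (angles are real numbers, not taken modulo $2\pi$); $H:1\to1$; the swap $\sigma:2\to2$; the cup $\epsilon:2\to0$; the cap $\eta:0\to2$. The identity on $n$ is $1_n$, and $e=1_0$ is the empty diagram. $D_2\circ D_1$ means first $D_1$ then $D_2$; in $D_1\otimes D_2$, $D_1$ is on the left. Put $R_Z^{(n,m)}:=R_Z^{(n,m)}(0)$, $R_X^{(n,m)}:=R_X^{(n,m)}(0)$. **Only connectivity matters (meta rule).** $G_D=(V,E,\ell)$ has one vertex for each spider, each $H$, each input and each output of $D$, and one edge for each wire of $D$ (wires being followed through swaps, cups and caps), joining the vertices at its two ends. A green (red) spider of angle $\alpha$ is labelled $R_Z(\alpha)$ ($R_X(\alpha)$), an $H$ is labelled $H$, the $j$-th input (output) from the left is labelled $I_j$ ($O_j$). The order and direction in which wires are attached to a spider or $H$ is not recorded. The meta rule: $D_1=D_2$ whenever there is a bijection of the vertices of $G_{D_1}$ and $G_{D_2}$ preserving labels and the number of edges between any two (possibly equal) vertices, and the two diagrams have the same number of closed wire loops carrying no vertex. **Calculus.** For a set $R$ of rules, $R\vdash D_1=D_2$ means that $(D_1,D_2)$ belongs to the smallest equivalence relation on parallel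 diagrams that is closed under $\circ$ and $\otimes$ and contains all equations in $R$. $\mathrm{ZX}_{\mathsf{simp}}$ consists of the meta rule above and of the following rules; $\mathrm{ZX}_{\mathsf{simp}}\setminus\{(\mathrm X),(\mathrm Y)\}$ is obtained by deleting the rules (X) and (Y). - (S1) for all $a,b,c,d\ge0$, $k\ge1$ and all $\alpha,\beta$: $(1_b\otimes R_Z^{(k+c,d)}(\beta))\circ(R_Z^{(a,b+k)}(\alpha)\otimes1_c)=R_Z^{(a+c,b+d)}(\alpha+\beta)$ (ordinary addition of angles). - (S3$'$L) $\eta=R_Z^{(0,2)}$; (S3$'$R) $R_Z^{(0,2)}=R_X^{(0,2)}$. - (B1) $(R_Z^{(1,0)}\circ R_X^{(0,1)})\otimes(R_Z^{(1,2)}\circ R_X^{(0,1)})=R_X^{(0,1)}\otimes R_X^{(0,1)}$. - (B2$'$) $R_Z^{(0,0)}\otimes\big[(R_X^{(2,1)}\otimes R_X^{(2,1)})\circ(1_1\otimes\sigma\otimes1_1)\circ(R_Z^{(1,2)}\otimes R_Z^{(1,2)})\big]=(R_Z^{(1,0)}\circ R_X^{(0,1)})\otimes(R_Z^{(1,2)}\circ R_X^{(2,1)})$. - (EU$'$) $H=R_Z^{(1,1)}(\tfrac\pi2)\circ R_X^{(2,1)}\circ(R_Z^{(0,1)}(-\tfrac\pi2)\otimes1_1)\circ R_Z^{(1,1)}(\tfrac\pi2)$. - (H) for all $n,m,\alpha$: $H^{\otimes m}\circ R_X^{(n,m)}(\alpha)\circ H^{\otimes n}=R_Z^{(n,m)}(\alpha)$.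 - (IV$'$) $R_Z^{(0,0)}\otimes(R_X^{(3,0)}\circ R_Z^{(0,3)})\otimes(R_X^{(3,0)}\circ R_Z^{(0,3)})=e$. - (ZO$'$) $R_Z^{(0,0)}(\pi)\otimes R_Z^{(0,1)}=R_Z^{(0,0)}(\pi)\otimes R_X^{(0,1)}$. *)

(* Defs.v *)
From HB Require Import structures.
From mathcomp Require Import all_boot all_order all_algebra.

Set Implicit Arguments.
Unset Strict Implicit.
Unset Printing Implicit Defensive.

Import GRing.Theory.

(* The angle k * pi/2 is encoded by the integer k. Angles are not taken
   modulo 2 pi, so distinct integers are distinct angles. *)
Definition angle : Type := int.
Definition zero_angle : angle := 0%R.
Definition half_pi : angle := 1%R.
Definition minus_half_pi : angle := (- 1)%R.
Definition pi_angle : angle := 2%R.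
Definition add_angle (a b : angle) : angle := (a + b)%R.

(* Morphisms n -> m of the free strict monoidal category are the terms D with
   [wf D], [dom D = n] and [cod D = m], modulo [strict_monoidal]. Raw terms
   avoid casts along associativity of addition on the objects. *)
Inductive diagram : Type :=
| Id of nat
| RZ of nat & nat & angle
| RX of nat & nat & angle
| H
| Swap
| Cup
| Cap
| Comp of diagram & diagram
| Tens of diagram & diagram.

Declare Scope diagram_scope.
Delimit Scope diagram_scope with D.
Bind Scope diagram_scope with diagram.

(* D2 ∘ D1 is first D1, then D2. *)
Notation "D2 ∘ D1" := (Comp D2 D1) (at level 45, right associativity)
  : diagram_scope.
Notation "D1 ⊗ D2" := (Tens D1 D2) (at level 40, left associativity)
  : diagram_scope.
Local Open Scope diagram_scope.

Notation RZ0 n m := (RZ n m zero_angle).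
Notation RX0 n m := (RX n m zero_angle).

Fixpoint dom (D : diagram) : nat :=
  match D with
  | Id n => n
  | RZ n _ _ | RX n _ _ => n
  | H => 1
  | Swap => 2
  | Cup => 2
  | Cap => 0
  | _ ∘ D1 => dom D1
  | D1 ⊗ D2 => dom D1 + dom D2
  end.

Fixpoint cod (D : diagram) : nat :=
  match D with
  | Id n => n
  | RZ _ m _ | RX _ m _ => m
  | H => 1
  | Swap => 2
  | Cup => 0
  | Cap => 2
  | D2 ∘ _ => cod D2
  | D1 ⊗ D2 => cod D1 + cod D2
  end.

Fixpoint wf (D : diagram) : bool :=
  match D with
  | D2 ∘ D1 => [&& wf D1, wf D2 & cod D1 == dom D2]
  | D1 ⊗ D2 => wf D1 && wf D2
  | _ => true
  end.

Definition parallel (D1 D2 : diagram) : Prop :=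
  [/\ wf D1, wf D2, dom D1 = dom D2 & cod D1 = cod D2].

Fixpoint tens_pow (D : diagram) (k : nat) : diagram :=
  if k is k'.+1 then D ⊗ tens_pow D k' else Id 0.

Inductive strict_monoidal : diagram -> diagram -> Prop :=
| sm_compA A B C : wf (C ∘ (B ∘ A)) ->
    strict_monoidal (C ∘ (B ∘ A)) ((C ∘ B) ∘ A)
| sm_compl D : wf D -> strict_monoidal (Id (cod D) ∘ D) D
| sm_compr D : wf D -> strict_monoidal (D ∘ Id (dom D)) D
| sm_tensA A B C : wf (A ⊗ (B ⊗ C)) ->
    strict_monoidal (A ⊗ (B ⊗ C)) ((A ⊗ B) ⊗ C)
| sm_tensl D : wf D -> strict_monoidal (Id 0 ⊗ D) D
| sm_tensr D : wf D -> strict_monoidal (D ⊗ Id 0) D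
| sm_tens_id n m : strict_monoidal (Id n ⊗ Id m) (Id (n + m))
| sm_interchange A B A' B' : wf ((B ∘ A) ⊗ (B' ∘ A')) ->
    strict_monoidal ((B ∘ A) ⊗ (B' ∘ A')) ((B ⊗ B') ∘ (A ⊗ A')).

Inductive label : Type :=
| LabelZ of angle
| LabelX of angle
| LabelH
| LabelIn of nat
| LabelOut of nat.

(* The wires of a diagram are cut into pieces (the points); [joined] relates
   pieces glued by a composition, so the wires are the connected components of
   [joined]. [legs v] lists the pieces attached to the spider or H [v], with
   multiplicity; the list order is never used. *)
Record wiring : Type := Wiring {
  point : finType;
  node : finType;
  node_label : node -> label;
  legs : node -> seq point;
  joined : rel point;
  ins : seq point;
  outs : seq point }.

Definition no_label (v : void) : label := match v with end.
Definition no_legs (P : Type) (v : void) : seq P := match v with end.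

Definition bare_wiring (P : finType) (i o : seq P) : wiring :=
  @Wiring P void no_label (@no_legs P) (fun _ _ => false) i o.

Definition node_wiring (l : label) (n m : nat) : wiring :=
  @Wiring ('I_n + 'I_m)%type unit (fun=> l)
    (fun=> map inl (enum 'I_n) ++ map inr (enum 'I_m))
    (fun _ _ => false) (map inl (enum 'I_n)) (map inr (enum 'I_m)).

Section Combine.
Variables W1 W2 : wiring.

Definition sum_label (v : node W1 + node W2) : label :=
  match v with inl v1 => node_label v1 | inr v2 => node_label v2 end.

Definition sum_legs (v : node W1 + node W2) : seq (point W1 + point W2) :=
  match v with
  | inl v1 => map inl (legs v1)
  | inr v2 => map inr (legs v2)
  end.

(* [glue] lists the pairs of pieces to be joined across the two parts. *)
Definition sum_joined (glue : seq (point W1 * point W2)) :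
    rel (point W1 + point W2) := fun p q =>
  match p, q with
  | inl p1, inl q1 => joined p1 q1
  | inr p2, inr q2 => joined p2 q2
  | inl p1, inr q2 => (p1, q2) \in glue
  | inr p2, inl q1 => (q1, p2) \in glue
  end.

(* W1 followed by W2. *)
Definition seq_wiring : wiring :=
  @Wiring (point W1 + point W2)%type (node W1 + node W2)%type
    sum_label sum_legs (sum_joined (zip (outs W1) (ins W2)))
    (map inl (ins W1)) (map inr (outs W2)).

Definition par_wiring : wiring :=
  @Wiring (point W1 + point W2)%type (node W1 + node W2)%type
    sum_label sum_legs (sum_joined [::])
    (map inl (ins W1) ++ map inr (ins W2))
    (map inl (outs W1) ++ map inr (outs W2)).

End Combine.

Fixpoint wiring_of (D : diagram) : wiring :=
  match D with
  | Id n => bare_wiring (enum 'I_n) (enum 'I_n)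
  | RZ n m a => node_wiring (LabelZ a) n m
  | RX n m a => node_wiring (LabelX a) n m
  | H => node_wiring LabelH 1 1
  | Swap => bare_wiring [:: false; true] [:: true; false]
  | Cup => bare_wiring [:: tt; tt] [::]
  | Cap => bare_wiring [::] [:: tt; tt]
  | D2 ∘ D1 => seq_wiring (wiring_of D1) (wiring_of D2)
  | D1 ⊗ D2 => par_wiring (wiring_of D1) (wiring_of D2)
  end.

Section Graph.
Variable D : diagram.
Let W := wiring_of D.

Definition vertex : finType :=
  (node W + ('I_(size (ins W)) + 'I_(size (outs W))))%type.

(* Inputs and outputs are numbered from 0. *)
Definition vertex_label (v : vertex) : label :=
  match v with
  | inl x => node_label x
  | inr (inl j) => LabelIn j
  | inr (inr j) => LabelOut j
  end.

Definition vertex_legs (v : vertex) : seq (point W) :=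
  match v with
  | inl x => legs x
  | inr (inl j) => [:: tnth (in_tuple (ins W)) j]
  | inr (inr j) => [:: tnth (in_tuple (outs W)) j]
  end.

Definition wires : {set {set point W}} :=
  [set [set q | connect (@joined W) p q] | p in [set: point W]].

Definition wire_ends (w : {set point W}) (v : vertex) : nat :=
  count (mem w) (vertex_legs v).

(* A wire joins u and v when its two ends are exactly u and v; if u = v, both
   ends are at u. *)
Definition edges (u v : vertex) : nat :=
  #|[set w in wires | [forall x, wire_ends w x == (x == u) + (x == v)]]|.

Definition loops : nat :=
  #|[set w in wires | [forall x, wire_ends w x == 0]]|.

End Graph.

Definition same_connectivity (D1 D2 : diagram) : Prop :=
  (exists f : vertex D1 -> vertex D2,
     [/\ bijective f,
         forall v, vertex_label (f v) = vertex_label v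
       & forall u v, edges (f u) (f v) = edges u v])
  /\ loops D1 = loops D2.

Definition B2_lhs : diagram :=
  RZ0 0 0 ⊗ ((RX0 2 1 ⊗ RX0 2 1) ∘ (Id 1 ⊗ Swap ⊗ Id 1)
              ∘ (RZ0 1 2 ⊗ RZ0 1 2)).
Definition B2_rhs : diagram :=
  (RZ0 1 0 ∘ RX0 0 1) ⊗ (RZ0 1 2 ∘ RX0 2 1).

Definition S3R_lhs : diagram := RZ0 0 2.
Definition S3R_rhs : diagram := RX0 0 2.

Inductive rule : Type :=
| Meta | S1 | S3L | S3R | B1 | B2 | EU | HH | IV | ZO.

Inductive rule_eq : rule -> diagram -> diagram -> Prop :=
| Meta_eq D1 D2 : parallel D1 D2 -> same_connectivity D1 D2 ->
    rule_eq Meta D1 D2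
| S1_eq a b c d k (x y : angle) : 1 <= k ->
    rule_eq S1
      ((Id b ⊗ RZ (k + c) d y) ∘ (RZ a (b + k) x ⊗ Id c))
      (RZ (a + c) (b + d) (add_angle x y))
| S3L_eq : rule_eq S3L Cap (RZ0 0 2)
| S3R_eq : rule_eq S3R S3R_lhs S3R_rhs
| B1_eq : rule_eq B1
    ((RZ0 1 0 ∘ RX0 0 1) ⊗ (RZ0 1 2 ∘ RX0 0 1))
    (RX0 0 1 ⊗ RX0 0 1)
| B2_eq : rule_eq B2 B2_lhs B2_rhs
| EU_eq : rule_eq EU H
    (RZ 1 1 half_pi ∘ RX0 2 1 ∘ (RZ 0 1 minus_half_pi ⊗ Id 1)
      ∘ RZ 1 1 half_pi)
| HH_eq n m (a : angle) : rule_eq HH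
    (tens_pow H m ∘ RX n m a ∘ tens_pow H n) (RZ n m a)
| IV_eq : rule_eq IV
    (RZ0 0 0 ⊗ (RX0 3 0 ∘ RZ0 0 3) ⊗ (RX0 3 0 ∘ RZ0 0 3)) (Id 0)
| ZO_eq : rule_eq ZO
    (RZ 0 0 pi_angle ⊗ RZ0 0 1) (RZ 0 0 pi_angle ⊗ RX0 0 1).

Definition rules : Type := rule -> Prop.
Definition ZX_simp : rules := fun=> True.
Definition without (R : rules) (r : rule) : rules := fun s => R s /\ s <> r.

Inductive derives (R : rules) : diagram -> diagram -> Prop :=
| der_rule r D1 D2 : R r -> rule_eq r D1 D2 -> derives R D1 D2
| der_strict D1 D2 : strict_monoidal D1 D2 -> derives R D1 D2
| der_refl D : wf D -> derives R D D
| der_sym D1 D2 : derives R D1 D2 -> derives R D2 D1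
| der_trans D1 D2 D3 :
    derives R D1 D2 -> derives R D2 D3 -> derives R D1 D3
| der_comp A A' B B' : cod A = dom B ->
    derives R A A' -> derives R B B' -> derives R (B ∘ A) (B' ∘ A')
| der_tens A A' B B' :
    derives R A A' -> derives R B B' -> derives R (A ⊗ B) (A' ⊗ B').

(* Main.v *)
Require Import Defs.
From mathcomp Require Import all_boot all_order all_algebra.
From mathcomp Require Import zify ring.

(** A qubit tensor-network model over a field satisfies every rule except (B2')
and (S3'R). Write [h], [zeta], [i] for scalars with [i^2 = -1]; interpret
- [H] as [h] times the matrix [[1, 1], [1, -1]],
- the green spider of angle [k pi/2] as [zeta^k |0..0> + (zeta i)^k |1..1>],
- the red spider as the green one with [H^-1] on every leg, as (H) forces.
Any such model satisfies (S1), (S3'L), (H), (B1) and the meta rule, and also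
(ZO') since [zeta^2 (1 + i^2) = 0]. With [s = 2 h^2], rule (EU') amounts to
[zeta = s^2] and (IV') to [s^3 = 1], whereas (S3'R) and (B2') each amount to
[s = 1]. A primitive cube root of unity [s] therefore separates them.

For the meta rule, the interpretation is a sum, over all labellings of the wires
by bits, of a product of vertex weights. A wire carrying a vertex has exactly two
ends, so that the edge counts and the number of loops determine this sum. *)

Set Implicit Arguments.
Unset Strict Implicit.
Unset Printing Implicit Defensive.

Import GRing.Theory.
Local Open Scope ring_scope.

(** * Sums over bit strings and over labellings *)

Section BitSum.
Variable R : comNzRingType.
Implicit Types (n m : nat) (s c : seq bool) (f g : seq bool -> R).

Fixpoint bit_sum n f : R :=
  if n is n'.+1 then
    bit_sum n' (fun s => f (false :: s)) + bit_sum n' (fun s => f (true :: s))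
  else f [::].

Lemma eq_bit_sum n f g :
  (forall s, size s = n -> f s = g s) -> bit_sum n f = bit_sum n g.
Proof.
elim: n f g => [|n IHn] f g fg /=; first exact: fg.
by congr (_ + _); apply: IHn => s ss; apply: fg; rewrite /= ss.
Qed.

Lemma bit_sum_sum (I : Type) (r : seq I) (P : pred I) n (F : I -> seq bool -> R) :
  bit_sum n (fun s => \sum_(i <- r | P i) F i s)
  = \sum_(i <- r | P i) bit_sum n (F i).
Proof.
elim: n F => [|n IHn] F //=.
by rewrite !IHn -big_split.
Qed.

Lemma bit_sumD n f g :
  bit_sum n (fun s => f s + g s) = bit_sum n f + bit_sum n g.
Proof. by elim: n f g => [|n IHn] f g //=; rewrite !IHn addrACA. Qed.

Lemma bit_sum_mull n x f : bit_sum n (fun s => x * f s) = x * bit_sum n f.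
Proof. by elim: n f => [|n IHn] f //=; rewrite !IHn mulrDr. Qed.

Lemma bit_sum_mulr n x f : bit_sum n (fun s => f s * x) = bit_sum n f * x.
Proof. by elim: n f => [|n IHn] f //=; rewrite !IHn mulrDl. Qed.

Lemma exchange_bit_sum n m (F : seq bool -> seq bool -> R) :
  bit_sum n (fun s => bit_sum m (F s))
  = bit_sum m (fun c => bit_sum n (fun s => F s c)).
Proof. by elim: n F => [|n IHn] F //=; rewrite !IHn bit_sumD. Qed.

Lemma bit_sum_cat n m f :
  bit_sum (n + m) f = bit_sum n (fun s => bit_sum m (fun c => f (s ++ c))).
Proof. by elim: n f => [|n IHn] f //=; rewrite !IHn. Qed.

Lemma bit_sum_delta s f :
  bit_sum (size s) (fun c => (s == c)%:R * f c) = f s.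
Proof.
elim: s f => [|x s IHs] f /=; first by rewrite mul1r.
rewrite -[RHS](IHs (fun c => f (x :: c))).
case: x; [rewrite addrC|].
all: rewrite [X in _ + X](eq_bit_sum (g := fun=> 0 * 0)) ?bit_sum_mull ?mul0r ?addr0.
all: by move=> *; rewrite ?eqseq_cons ?mul0r.
Qed.

End BitSum.

Section StateSum.
Variable R : comNzRingType.
Variable weight : label -> nat -> nat -> R.

(** Bits are placed on the pieces rather than on the wires; this condition makes the bit constant
    along each wire. *)
Definition respects (W : wiring) (phi : {ffun point W -> bool}) : bool :=
  [forall p, forall q, joined p q ==> (phi p == phi q)].

Definition node_value (W : wiring) (phi : {ffun point W -> bool}) (v : node W) : R :=
  weight (node_label v) (count (fun p => ~~ phi p) (legs v)) (count phi (legs v)).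

Definition state_sum (W : wiring) (a b : seq bool) : R :=
  \sum_(phi : {ffun point W -> bool} |
      [&& respects phi, map phi (ins W) == a & map phi (outs W) == b])
    \prod_v node_value phi v.

Definition join_ffun (A B : finType) (f : {ffun A -> bool}) (g : {ffun B -> bool}) :
    {ffun (A + B)%type -> bool} :=
  [ffun x => match x with inl y => f y | inr y => g y end].

Lemma big_join_ffun (A B : finType) (F : {ffun (A + B)%type -> bool} -> R) :
  \sum_phi F phi = \sum_f \sum_g F (join_ffun f g).
Proof.
rewrite pair_big /=.
rewrite (reindex (fun p : {ffun A -> bool} * {ffun B -> bool} => join_ffun p.1 p.2)) //=.
exists (fun phi : {ffun (A + B)%type -> bool} =>
          ([ffun x => phi (inl x)], [ffun x => phi (inr x)])) => [[f g] _ | phi _] /=.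
  by congr (_, _); apply/ffunP => x; rewrite !ffunE.
by apply/ffunP => -[] x; rewrite !ffunE.
Qed.

Lemma join_ffun_inl (A B : finType) (f : {ffun A -> bool}) (g : {ffun B -> bool}) s :
  map (join_ffun f g) (map inl s) = map f s.
Proof. by rewrite -map_comp; apply: eq_map => x /=; rewrite ffunE. Qed.

Lemma join_ffun_inr (A B : finType) (f : {ffun A -> bool}) (g : {ffun B -> bool}) s :
  map (join_ffun f g) (map inr s) = map g s.
Proof. by rewrite -map_comp; apply: eq_map => x /=; rewrite ffunE. Qed.

Section TwoWirings.
Variables W1 W2 : wiring.
Implicit Types (f : {ffun point W1 -> bool}) (g : {ffun point W2 -> bool}).

Lemma sum_node_prod f g :
  \prod_(v : node W1 + node W2)
    weight (sum_label v)
      (count (fun p => ~~ join_ffun f g p) (sum_legs v))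
      (count (join_ffun f g) (sum_legs v))
  = (\prod_v node_value f v) * (\prod_v node_value g v).
Proof.
rewrite big_sumType /=; congr (_ * _); apply: eq_bigr => v _;
  rewrite /node_value !count_map; congr (weight _ _ _);
  by apply: eq_count => x /=; rewrite ffunE.
Qed.

Definition glue_respected (glue : seq (point W1 * point W2)) f g : bool :=
  all (fun pq => f pq.1 == g pq.2) glue.

Lemma respects_sum_joined glue f g :
  [forall p, forall q, sum_joined glue p q ==> (join_ffun f g p == join_ffun f g q)]
  = [&& respects f, respects g & glue_respected glue f g].
Proof.
apply/forallP/and3P => [fgP | [/forallP fP /forallP gP /allP glP] [] p].
- split; first 1 last.
  + apply/forallP => p; apply/forallP => q.
    by have /forallP /(_ (inr q)) := fgP (inr p); rewrite !ffunE.
  + apply/allP => -[p q] pq /=.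
    by have /forallP /(_ (inr q)) := fgP (inl p); rewrite !ffunE /= pq.
  + apply/forallP => p; apply/forallP => q.
    by have /forallP /(_ (inl q)) := fgP (inl p); rewrite !ffunE.
- apply/forallP => -[] q; rewrite !ffunE /=.
    by have /forallP := fP p; apply.
  by apply/implyP => /glP.
- apply/forallP => -[] q; rewrite !ffunE /=.
    by apply/implyP => /glP /=; rewrite eq_sym.
  by have /forallP := gP p; apply.
Qed.

Lemma glue_respected_zip (s : seq (point W1)) (t : seq (point W2)) f g :
  size s = size t -> glue_respected (zip s t) f g = (map f s == map g t).
Proof.
elim: s t => [|x s IHs] [|y t] //= [st].
by rewrite eqseq_cons -IHs.
Qed.

Lemma respects_seq f g : size (outs W1) = size (ins W2) ->
  @respects (seq_wiring W1 W2) (join_ffun f g)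
  = [&& respects f, respects g & map f (outs W1) == map g (ins W2)].
Proof. by move=> sz; rewrite -glue_respected_zip //; apply: respects_sum_joined. Qed.

Lemma respects_par f g :
  @respects (par_wiring W1 W2) (join_ffun f g) = respects f && respects g.
Proof. by rewrite [LHS]respects_sum_joined andbT. Qed.

(** Labellings of the two parts that agree along the interface are sorted by the common string [c]
    which they put there. *)
Lemma state_sum_seq a b : size (outs W1) = size (ins W2) ->
  state_sum (seq_wiring W1 W2) a b
  = bit_sum (size (outs W1)) (fun c => state_sum W1 a c * state_sum W2 c b).
Proof.
move=> sz; rewrite /state_sum big_mkcond big_join_ffun.
rewrite (eq_bit_sum (g := fun c => \sum_f \sum_g
  (if [&& respects f, map f (ins W1) == a & map f (outs W1) == c]
    then \prod_v node_value f v else 0) *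
  (if [&& respects g, map g (ins W2) == c & map g (outs W2) == b]
    then \prod_v node_value g v else 0))); last first.
  move=> c _; rewrite big_mkcond mulr_suml; apply: eq_bigr => f _.
  by rewrite [X in _ * X]big_mkcond mulr_sumr.
rewrite bit_sum_sum; apply: eq_bigr => f _.
rewrite bit_sum_sum; apply: eq_bigr => g _.
rewrite (respects_seq f g sz) /= join_ffun_inl join_ffun_inr.
rewrite [X in if _ then X else _]sum_node_prod.
set F := \prod_v _; set G := \prod_v _.
(* For a fixed pair of labellings only [c = map f (outs W1)] can contribute. In delta form the sum
   over [c] collapses, and what remains of it is the gluing condition. *)
rewrite -(size_map f) (eq_bit_sum (g := fun c => (map f (outs W1) == c)%:R *
  ((if [&& respects f, respects g, map f (ins W1) == a & map g (outs W2) == b]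
    then F * G else 0) * (map g (ins W2) == c)%:R))); last first.
  move=> c _; case: (respects f); case: (respects g); case: (map f (ins W1) == a);
    case: (map f (outs W1) == c); case: (map g (ins W2) == c);
    case: (map g (outs W2) == b); by rewrite /= ?mul0r ?mulr0 ?mul1r ?mulr1.
rewrite bit_sum_delta (eq_sym (map g (ins W2))).
by case: (respects f); case: (respects g); case: (map f (ins W1) == a);
  case: (map g (outs W2) == b); case: (map f (outs W1) == _);
  rewrite /= ?mul0r ?mulr0 ?mulr1.
Qed.

Lemma state_sum_par a b :
  state_sum (par_wiring W1 W2) a b
  = state_sum W1 (take (size (ins W1)) a) (take (size (outs W1)) b)
    * state_sum W2 (drop (size (ins W1)) a) (drop (size (outs W1)) b).
Proof.
rewrite /state_sum big_mkcond big_join_ffun.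
rewrite [in RHS](big_mkcond _ (fun f => \prod_v _)) mulr_suml.
apply: eq_bigr => f _; rewrite [X in _ * X]big_mkcond mulr_sumr.
apply: eq_bigr => g _.
rewrite respects_par /= !map_cat !join_ffun_inl !join_ffun_inr.
rewrite [X in if _ then X else _]sum_node_prod.
have catE (s t u : seq bool) :
    (s ++ t == u) = (s == take (size s) u) && (t == drop (size s) u).
  apply/eqP/andP => [<-|[/eqP sE /eqP ->]].
    by rewrite take_size_cat // drop_size_cat.
  by rewrite {1}sE cat_take_drop.
rewrite !catE !size_map.
by case: (respects f); case: (respects g); case: (map f (ins W1) == _);
  case: (map f (outs W1) == _); case: (map g (ins W2) == _);
  case: (map g (outs W2) == _); rewrite /= ?mul0r ?mulr0.
Qed.

End TwoWirings.
End StateSum.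

(** * Interpretation of diagrams *)

Lemma size_wiring D : wf D ->
  size (ins (wiring_of D)) = dom D /\ size (outs (wiring_of D)) = cod D.
Proof.
elim: D => [n|n m x|n m x|||||D2 IH2 D1 IH1|D1 IH1 D2 IH2] //=;
  rewrite ?size_map -?enumT ?size_enum_ord -?enumT ?size_enum_ord //.
- by case/and3P=> /IH1[i1 _] /IH2[_ o2] _.
- by case/andP=> /IH1[i1 o1] /IH2[i2 o2]; rewrite !size_cat !size_map i1 o1 i2 o2.
Qed.

Section Interpretation.
Variable R : comNzRingType.
Variable weight : label -> nat -> nat -> R.

(** Only the numbers of 0s and 1s on the legs enter, inputs and outputs alike, so the value is blind
    to the order and direction of the legs. *)
Definition spider (l : label) (s : seq bool) : R :=
  weight l (count negb s) (count id s).

(** A matrix semantics, input string first, that evaluates by recursion on the term. The concrete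
    rules are verified on it, while the meta rule is proved on [state_sum], which sees the wires.
    Values at strings of the wrong length are meaningless. *)
Fixpoint interp (D : diagram) (a b : seq bool) : R :=
  match D with
  | Id _ => (a == b)%:R
  | RZ _ _ x => spider (LabelZ x) (a ++ b)
  | RX _ _ x => spider (LabelX x) (a ++ b)
  | H => spider LabelH (a ++ b)
  | Swap => (b == rev a)%:R
  | Cup => (nth false a 0 == nth false a 1)%:R
  | Cap => (nth false b 0 == nth false b 1)%:R
  | Comp D2 D1 => bit_sum (cod D1) (fun c => interp D1 a c * interp D2 c b)
  | Tens D1 D2 =>
      interp D1 (take (dom D1) a) (take (cod D1) b)
      * interp D2 (drop (dom D1) a) (drop (cod D1) b)
  end.

Lemma map_enum_ord_eq n (f : {ffun 'I_n -> bool}) (a : seq bool) : size a = n ->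
  (map f (enum 'I_n) == a) = (f == [ffun i : 'I_n => nth false a i]).
Proof.
move=> sa; apply/eqP/eqP => [<-|->].
  apply/ffunP => i; rewrite ffunE (nth_map i) ?size_enum_ord //.
  by rewrite nth_ord_enum.
apply: (@eq_from_nth _ false) => [|i]; rewrite size_map size_enum_ord // => lt_in.
by rewrite (nth_map (Ordinal lt_in)) ?size_enum_ord // ffunE nth_enum_ord.
Qed.

Lemma sum_unique (I : finType) (P : pred I) (F : I -> R) i0 (c : bool) :
  (forall i, P i = (i == i0) && c) -> \sum_(i | P i) F i = c%:R * F i0.
Proof.
move=> PE; under eq_bigl do rewrite PE.
case: c {PE}; last by rewrite mul0r big_pred0 // => i; rewrite andbF.
by rewrite mul1r (big_pred1 i0) // => i; rewrite andbT.
Qed.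

(** In a wiring without nodes the boundary strings leave at most one labelling, [phi0], and [c]
    tells whether they are compatible; the weight is an empty product. *)
Lemma state_sum_bare (P : finType) (i o : seq P) a b phi0 (c : bool) :
  (forall phi : {ffun P -> bool},
     (map phi i == a) && (map phi o == b) = (phi == phi0) && c) ->
  state_sum weight (bare_wiring i o) a b = c%:R.
Proof.
move=> cE; rewrite /state_sum (sum_unique _ (i0 := phi0) (c := c)) => [|phi].
  by rewrite big_pred0 ?mulr1 // => -[].
rewrite -cE; case E: (@respects (bare_wiring i o) phi) => //=.
by move/negbT: E => /forallPn[p /forallPn[q]].
Qed.

Lemma state_sum_node l n m a b : size a = n -> size b = m ->
  state_sum weight (node_wiring l n m) a b = spider l (a ++ b).
Proof.
move=> sa sb; pose fa := [ffun i : 'I_n => nth false a i].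
pose fb := [ffun i : 'I_m => nth false b i].
rewrite /state_sum (sum_unique _ (i0 := join_ffun fa fb) (c := true)) => [|phi].
  rewrite mul1r (big_pred1 tt) => [|[]] //.
  rewrite /node_value /spider /= -(count_map (join_ffun fa fb) negb).
  rewrite -(count_map (join_ffun fa fb) id) map_cat.
  by rewrite join_ffun_inl join_ffun_inr (eqP (etrans (map_enum_ord_eq _ sa) (eqxx _)))
    (eqP (etrans (map_enum_ord_eq _ sb) (eqxx _))).
have -> : @respects (node_wiring l n m) phi by apply/forallP => p; apply/forallP.
rewrite andbT; pose f := [ffun x => phi (inl x)]; pose g := [ffun x => phi (inr x)].
have -> : phi = join_ffun f g by apply/ffunP => -[] x; rewrite !ffunE.
rewrite /= join_ffun_inl join_ffun_inr !map_enum_ord_eq //.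
apply/andP/eqP => [[/eqP-> /eqP->] // | /ffunP fgE].
by split; apply/eqP/ffunP => x; [have := fgE (inl x)|have := fgE (inr x)];
  rewrite !ffunE.
Qed.

Lemma state_sum_interp D a b : wf D -> size a = dom D -> size b = cod D ->
  state_sum weight (wiring_of D) a b = interp D a b.
Proof.
elim: D a b => [n|n m x|n m x|||||D2 IH2 D1 IH1|D1 IH1 D2 IH2] a b;
  rewrite [wiring_of _]/= [interp _ _ _]/=.
- move=> _ sa sb; apply: (state_sum_bare (phi0 := [ffun i : 'I_n => nth false a i])) => phi.
  by rewrite map_enum_ord_eq // -map_enum_ord_eq //; case: eqP => //= ->.
- by move=> _; apply: state_sum_node.
- by move=> _; apply: state_sum_node.
- by move=> _; apply: state_sum_node.
- case: a b => [|x [|y []]] // [|z [|w []]] // _ _ _.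
  apply: (state_sum_bare (phi0 := [ffun p : bool => nth false [:: x; y] p])) => phi.
  rewrite /rev /= !eqseq_cons !andbT; apply/idP/idP.
    case/andP=> /andP[/eqP xE /eqP yE] /andP[/eqP zE /eqP wE].
    rewrite -xE -yE -zE -wE !eqxx !andbT.
    by apply/eqP/ffunP => -[]; rewrite ffunE.
  by case/andP=> /eqP-> /andP[/eqP-> /eqP->]; rewrite !ffunE /= !eqxx.
- case: a b => [|x [|y []]] // [|] // _ _ _.
  apply: (state_sum_bare (phi0 := [ffun=> x])) => phi.
  rewrite /= !eqseq_cons !andbT; apply/andP/andP => [][/eqP xE /eqP yE].
    by rewrite -yE -xE; split=> //; apply/eqP/ffunP => -[]; rewrite ffunE.
  by rewrite xE -yE !ffunE.
- case: a b => [|] // [|x [|y []]] // _ _ _.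
  apply: (state_sum_bare (phi0 := [ffun=> x])) => phi.
  rewrite /= !eqseq_cons !andbT; apply/andP/andP => [][/eqP xE /eqP yE].
    by rewrite -yE -xE; split=> //; apply/eqP/ffunP => -[]; rewrite ffunE.
  by rewrite xE -yE !ffunE.
- case/and3P=> wf1 wf2 /eqP glue /= sa sb.
  have [_ so] := size_wiring wf1; have [si _] := size_wiring wf2.
  rewrite state_sum_seq so ?si //; apply: eq_bit_sum => c sc.
  by rewrite IH1 // IH2 // sc.
- case/andP=> wf1 wf2 /= sa sb; have [i1 o1] := size_wiring wf1.
  rewrite state_sum_par i1 o1 IH1 ?IH2 ?size_drop ?sa ?sb ?addKn //;
  by rewrite size_take_min ?sa ?sb; apply/minn_idPl; rewrite leq_addr.
Qed.

Definition same_interp (D1 D2 : diagram) : Prop :=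
  forall a b, size a = dom D1 -> size b = cod D1 -> interp D1 a b = interp D2 a b.

Lemma interp_strict D1 D2 : strict_monoidal D1 D2 ->
  parallel D1 D2 /\ same_interp D1 D2.
Proof.
case=> [A B C|D|D|A B C|D|D|n m|A B A' B'].
- move=> wfD; split; first split=> //=.
    by move: wfD => /= /and3P[/and3P[-> -> ->] -> ->].
  move=> a b sa sb /=; rewrite (eq_bit_sum (g := fun c => bit_sum (cod A) (fun d =>
    interp A a d * interp B d c * interp C c b))); last first.
    by move=> c _; rewrite bit_sum_mulr.
  rewrite exchange_bit_sum; apply: eq_bit_sum => d _.
  by rewrite -bit_sum_mull; apply: eq_bit_sum => c _; rewrite mulrA.
- move=> wfD; split; first by split=> //=; rewrite wfD eqxx.
  move=> a b sa /= sb.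
  rewrite (eq_bit_sum (g := fun c => (b == c)%:R * interp D a c)).
    by rewrite -sb bit_sum_delta.
  by move=> c _; rewrite eq_sym mulrC.
- move=> wfD; split; first by split=> //=; rewrite wfD eqxx.
  by move=> a b /= sa sb; rewrite -sa bit_sum_delta.
- move=> wfD; split; first split=> //=; rewrite ?addnA //.
    by move: wfD => /= /and3P[-> -> ->].
  move=> a b /= sa sb; rewrite mulrA !take_takel ?leq_addr // !drop_drop.
  by rewrite !take_drop (addnC (dom B)) (addnC (cod B)) !(addnC (dom A)) !(addnC (cod A)).
- by move=> wfD; split=> // a b sa sb /=; rewrite !take0 !drop0 mul1r.
- move=> wfD; split; first by split=> //=; rewrite ?wfD ?addn0.
  move=> a b /=; rewrite !addn0 => sa sb.
  by rewrite !take_oversize ?drop_oversize ?sa ?sb // eqxx mulr1.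
- split=> // a b /= sa sb.
  have szt : size (take n a) = size (take n b) by rewrite !size_take_min sa sb.
  by rewrite -{3}(cat_take_drop n a) -{3}(cat_take_drop n b) eqseq_cat // -natrM mulnb.
- move=> wfD; split; first split=> //=.
    by move: wfD => /= /andP[/and3P[-> -> /eqP->] /and3P[-> -> /eqP->]]; rewrite eqxx.
  move=> a b sa sb /=; move: wfD => /= /andP[/and3P[_ _ /eqP gl] /and3P[_ _ /eqP gl']].
  rewrite bit_sum_cat -bit_sum_mulr; apply: eq_bit_sum => c sc.
  rewrite -bit_sum_mull; apply: eq_bit_sum => d sd.
  rewrite take_size_cat // drop_size_cat // take_size_cat ?drop_size_cat ?sc //.
  by rewrite mulrACA.
Qed.

Lemma equiv_comp A A' B B' : parallel A A' -> cod A = dom B ->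
  same_interp A A' -> same_interp B B' -> same_interp (Comp B A) (Comp B' A').
Proof.
move=> [_ _ _ codA] gl eA eB a b /= sa sb; rewrite -codA; apply: eq_bit_sum => c sc.
by rewrite eA ?eB // sc.
Qed.

Lemma equiv_tens A A' B B' : parallel A A' ->
  same_interp A A' -> same_interp B B' -> same_interp (Tens A B) (Tens A' B').
Proof.
move=> [_ _ domA codA] eA eB a b /= sa sb; rewrite -domA -codA.
rewrite eA ?eB // ?size_drop ?sa ?sb ?addKn // size_take_min;
by apply/minn_idPl; rewrite ?sa ?sb leq_addr.
Qed.

(** Parallelism is carried through the induction because composition and tensor cut strings at
    lengths read off the terms, which must agree on both sides. *)
Lemma derives_sound (S : rules) :
  (forall r D1 D2, S r -> rule_eq r D1 D2 -> parallel D1 D2 /\ same_interp D1 D2) ->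
  forall D1 D2, derives S D1 D2 -> parallel D1 D2 /\ same_interp D1 D2.
Proof.
move=> sound D1 D2; elim=> {D1 D2}.
- exact: sound.
- exact: interp_strict.
- by [].
- move=> D1 D2 _ [[w1 w2 dE cE] e12]; split; first by split.
  by move=> a b sa sb; rewrite e12 ?dE ?cE.
- move=> D1 D2 D3 _ [[w1 w2 dE cE] e12] _ [[_ w3 dE' cE'] e23]; split.
    by split=> //; [rewrite dE | rewrite cE].
  by move=> a b sa sb; rewrite e12 // e23 // -?dE -?cE.
- move=> A A' B B' gl _ [pA eA] _ [pB eB]; split; last exact: equiv_comp.
  case: pA pB => [wA wA' dA cA] [wB wB' dB cB].
  by split=> //=; apply/and3P; split=> //; apply/eqP; rewrite // -cA gl.
- move=> A A' B B' _ [pA eA] _ [pB eB]; split; last exact: equiv_tens.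
  case: pA pB => [wA wA' dA cA] [wB wB' dB cB].
  by split; rewrite /= ?wA ?wA' ?dA ?cA ?dB ?cB.
Qed.

End Interpretation.

(** * Every wire has zero or two ends *)

Section Gluing.
Variable T : finType.
Implicit Types (r : rel T) (g : seq (T * T)) (L : seq T).

Lemma connect_min r (S : rel T) x y :
  (forall z, S z z) -> (forall u v z, r u v -> S v z -> S u z) ->
  connect r x y -> S x y.
Proof.
move=> S0 S1 /connectP[s rs ->] {y}.
by elim: s x rs => [|u s IHs] x //= /andP[rxu /IHs]; apply: S1.
Qed.

Lemma connect_none (x : T) : connect (fun _ _ => false) x =1 pred1 x.
Proof.
move=> y; apply/idP/eqP => [|->]; last exact: connect0.
by move/(@connect_min _ (fun u v => v == u)) => /(_ (@eqxx _)) xy; apply/eqP/xy.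
Qed.

Definition glued r g : rel T :=
  fun x y => [|| r x y, (x, y) \in g | (y, x) \in g].

Lemma glued_sym r g : symmetric r -> symmetric (glued r g).
Proof. by move=> rs x y; rewrite /glued rs; congr (_ || _); rewrite orbC. Qed.

(** A path that uses the new edge several times can be shortened to one that uses it at most once,
    in one of the two directions. *)
Lemma connect_glue1 r p q : symmetric r -> forall x y,
  connect (glued r [:: (p, q)]) x y
  = [|| connect r x y, connect r x p && connect r q y
      | connect r x q && connect r p y].
Proof.
move=> rs x y; have cs := sym_connect_sym rs.
have sub u v : connect r u v -> connect (glued r [:: (p, q)]) u v.
  by apply: connect_sub => {}u {}v ruv; apply: connect1; rewrite /glued ruv.
have gpq : connect (glued r [:: (p, q)]) p q.
  by apply: connect1; rewrite /glued mem_head orbT.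
have gqp : connect (glued r [:: (p, q)]) q p.
  by apply: connect1; rewrite /glued mem_head !orbT.
apply/idP/or3P => [|[/sub // | /andP[/sub xp /sub qy] | /andP[/sub xq /sub py]]].
- move=> xy; apply/or3P; move: xy.
  apply: (@connect_min _ (fun x y => [|| connect r x y,
    connect r x p && connect r q y | connect r x q && connect r p y])).
    by move=> z; rewrite connect0.
  move=> u v z; rewrite /glued !inE => /or3P[ruv||] .
  + have ruv' w : connect r v w -> connect r u w.
      exact: connect_trans (connect1 ruv).
    case/or3P=> [/ruv'->//|/andP[/ruv'-> ->]|/andP[/ruv'-> ->]];
    by rewrite ?orbT.
  + case/eqP=> -> ->; rewrite !connect0 /=.
    by case/or3P=> [->|/andP[_ ->]|->]; rewrite ?orbT.
  + case/eqP=> -> ->; rewrite !connect0 /=.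
    by case/or3P=> [->|->|/andP[_ ->]]; rewrite ?orbT.
- exact: connect_trans (connect_trans xp gpq) qy.
- exact: connect_trans (connect_trans xq gqp) py.
Qed.

(** [L] counts with multiplicity: one piece may supply both ends of its class, as on an identity
    wire. *)
Definition paired_ends r L : Prop :=
  forall x, count (connect r x) L \in [:: 0%N; 2].

(* A class with a pending end at [p] has one other end. Gluing [p] to [q] either
   merges two classes having one other end each, or closes a class into a loop. *)
Lemma paired_glue1 r p q L : symmetric r ->
  paired_ends r [:: p, q & L] -> paired_ends (glued r [:: (p, q)]) L.
Proof.
move=> rs paired x; have cs := sym_connect_sym rs.
have gE y : connect (glued r [:: (p, q)]) x y = _ := connect_glue1 p q rs x y.
rewrite (eq_count gE).
have tr u v w : connect r u v -> connect r v w = connect r u w.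
  by move=> uv; rewrite (same_connect cs uv).
have Nx := paired x; have Np := paired p; have Nq := paired q.
rewrite /= ?connect0 in Nx Np Nq.
case pq: (connect r p q) Np Nq; rewrite cs pq => Np Nq.
  have -> : count (fun y => [|| connect r x y, connect r x p && connect r q y
      | connect r x q && connect r p y]) L = count (connect r x) L.
    apply: eq_count => y; rewrite (tr p q) // .
    have -> : connect r x q = connect r x p by rewrite !(cs x) (same_connect cs pq).
    case xp: (connect r x p) => /=; last by rewrite orbF.
    by rewrite (tr x p) // orbb orbb.
  move: Nx; have -> : connect r x q = connect r x p by rewrite !(cs x) (same_connect cs pq).
  by case: (connect r x p); case: (count _ L) => [|[|[|]]].
case xp: (connect r x p) Nx => Nx.
  have xq : connect r x q = false by rewrite -(tr x p).
  rewrite xq in Nx *.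
  have := count_predUI (connect r x) (connect r q) L.
  rewrite [X in (_ + X)%N](eq_count (a2 := pred0)) ?count_pred0 ?addn0.
    rewrite (eq_count (a2 := fun y => [|| connect r x y, true && connect r q y
      | false && connect r p y])) => [->|y]; last by rewrite /= orbF.
    by move: (count (connect r x) L) (count (connect r q) L) Nx Nq => [|[|?]] [|[|?]].
  move=> y /=; apply/negP => /andP[xy qy].
  by move: xq; rewrite (connect_trans xy) // cs.
case xq: (connect r x q) Nx => Nx.
  have := count_predUI (connect r x) (connect r p) L.
  rewrite [X in (_ + X)%N](eq_count (a2 := pred0)) ?count_pred0 ?addn0.
    rewrite (eq_count (a2 := fun y => [|| connect r x y, false && connect r q y
      | true && connect r p y])) => [->|y]; last by [].
    by move: (count (connect r x) L) (count (connect r p) L) Nx Np => [|[|?]] [|[|?]].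
  move=> y /=; apply/negP => /andP[xy py].
  by move: xp; rewrite (connect_trans xy) // cs.
by rewrite (eq_count (a2 := connect r x)) // => y; rewrite /= orbF.
Qed.

(** The pairs are glued one at a time; each gluing uses up one occurrence of each of its two pieces
    from the list of pending ends. *)
Lemma paired_glue r g L : symmetric r ->
  paired_ends r (unzip1 g ++ unzip2 g ++ L) -> paired_ends (glued r g) L.
Proof.
elim: g r => [|[p q] g IHg] r rs paired.
  move=> x; rewrite (eq_count (a2 := connect r x)) // => y.
  by apply: eq_connect => u v; rewrite /glued !in_nil !orbF.
move=> x; rewrite (eq_count (a2 := connect (glued (glued r [:: (p, q)]) g) x)).
  apply: IHg; first exact: glued_sym.
  apply: paired_glue1 => // {}x; have := paired x.
  rewrite (permP (_ : perm_eq _ [:: p, q & unzip1 g ++ unzip2 g ++ L])) //=.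
  by rewrite perm_cons; apply/permPl/(perm_catCA _ [:: q]).
move=> y; apply: eq_connect => u v; rewrite /glued !in_cons !in_nil !orbF.
by case: (r u v); case: ((u, v) == _); case: ((v, u) == _); case: ((u, v) \in g).
Qed.

End Gluing.

Definition ends (W : wiring) : seq (point W) :=
  flatten [seq legs v | v <- enum (node W)] ++ ins W ++ outs W.

Lemma count_ends W (a : pred (point W)) :
  count a (ends W) = (\sum_v count a (legs v) + (count a (ins W) + count a (outs W)))%N.
Proof.
by rewrite !count_cat count_flatten -map_comp sumnE big_map big_enum.
Qed.

Lemma joined_sym D : symmetric (@joined (wiring_of D)).
Proof.
elim: D => [n|n m x|n m x|||||D2 IH2 D1 IH1|D1 IH1 D2 IH2] //=.
- by move=> [p|p] [q|q] //=.
- by move=> [p|p] [q|q] //=.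
Qed.

Section SumPaired.
Variables W1 W2 : wiring.
Hypotheses (sym1 : symmetric (@joined W1)) (sym2 : symmetric (@joined W2)).
Hypotheses (paired1 : paired_ends (@joined W1) (ends W1))
           (paired2 : paired_ends (@joined W2) (ends W2)).
Let r0 := @sum_joined W1 W2 [::].

Lemma connect_sum_joined0 x y : connect r0 x y =
  match x, y with
  | inl p, inl q => connect (@joined W1) p q
  | inr p, inr q => connect (@joined W2) p q
  | _, _ => false
  end.
Proof.
apply/idP/idP.
  apply: (@connect_min _ _ (fun x y => match x, y with
  | inl p, inl q => connect (@joined W1) p q
  | inr p, inr q => connect (@joined W2) p q
  | _, _ => false
  end)) => [[] z //|[] u [] v [] z //= uv].
  - exact: connect_trans (connect1 uv).
  - exact: connect_trans (connect1 uv).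
case: x y => p [] q //.
- apply: (@connect_min _ _ (fun p q => connect r0 (inl p) (inl q))) => // u v z uv.
  exact/connect_trans/connect1.
- apply: (@connect_min _ _ (fun p q => connect r0 (inr p) (inr q))) => // u v z uv.
  exact/connect_trans/connect1.
Qed.

Lemma sum_joined0_sym : symmetric r0.
Proof. by move=> [p|p] [q|q]; [apply: sym1 | | | apply: sym2]. Qed.

Lemma paired_sum (L : seq (point W1 + point W2)) :
  (forall a : pred (point W1 + point W2),
     count a L = (count (preim inl a) (ends W1) + count (preim inr a) (ends W2))%N) ->
  paired_ends r0 L.
Proof.
move=> LE x; rewrite LE; case: x => p.
  rewrite (eq_count (a2 := connect (@joined W1) p)) => [|q]; last exact: connect_sum_joined0.
  rewrite [X in (_ + X)%N](eq_count (a2 := pred0)) => [|q]; last exact: connect_sum_joined0.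
  by rewrite count_pred0 addn0; apply: paired1.
rewrite (eq_count (a2 := pred0)) => [|q]; last exact: connect_sum_joined0.
rewrite [X in (_ + X)%N](eq_count (a2 := connect (@joined W2) p)) => [|q];
  last exact: connect_sum_joined0.
by rewrite count_pred0; apply: paired2.
Qed.

Lemma count_sum_legs (a : pred (point W1 + point W2)) :
  (\sum_v count a (@sum_legs W1 W2 v)
   = \sum_v count (preim inl a) (legs v) + \sum_v count (preim inr a) (legs v))%N.
Proof.
by rewrite big_sumType /=; congr (_ + _)%N; apply: eq_bigr => v _; rewrite count_map.
Qed.

Lemma paired_par : paired_ends (@joined (par_wiring W1 W2)) (ends (par_wiring W1 W2)).
Proof.
apply: paired_sum => a.
rewrite [LHS](@count_ends (par_wiring W1 W2)) !count_ends /=.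
rewrite count_sum_legs !count_cat !count_map.
lia.
Qed.

(** Before gluing, the ends of the two parts are the ends of the composite together with the
    interface pieces on both sides. This is the list that [paired_glue] asks for, with the interface
    pairs [g] embedded in the disjoint union. *)
Lemma paired_seq : size (outs W1) = size (ins W2) ->
  paired_ends (@joined (seq_wiring W1 W2)) (ends (seq_wiring W1 W2)).
Proof.
move=> sz; pose pair (pq : point W1 * point W2) : _ * (point W1 + point W2) :=
  (inl pq.1 : point W1 + point W2, inr pq.2).
pose g := map pair (zip (outs W1) (ins W2)).
have pair_inj : injective pair by move=> [p q] [p' q'] [-> ->].
have joinedE : @joined (seq_wiring W1 W2) =2 glued r0 g.
  have ing p q : ((inl p, inr q) \in g) = ((p, q) \in zip (outs W1) (ins W2)).
    by rewrite -(mem_map pair_inj).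
  have ning p q : (p, inl q) \in g = false.
    by apply/mapP => -[[? ?] _ []].
  have ning' p q : (inr p, q) \in g = false.
    by apply/mapP => -[[? ?] _ []].
  by move=> [p|p] [q|q]; rewrite /glued ?ing ?ning ?ning' ?orbF.
move=> x; rewrite (eq_count (eq_connect joinedE x)).
apply: paired_glue; first exact: sum_joined0_sym.
apply: paired_sum => a.
have -> : unzip1 g = map inl (outs W1).
  by rewrite -(unzip1_zip (_ : size (outs W1) <= size (ins W2))%N) ?sz // /unzip1 -!map_comp.
have -> : unzip2 g = map inr (ins W2).
  by rewrite -(unzip2_zip (_ : size (ins W2) <= size (outs W1))%N) ?sz // /unzip2 -!map_comp.
rewrite 2!count_cat [X in (_ + (_ + X))%N = _](@count_ends (seq_wiring W1 W2)) !count_ends /=.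
rewrite count_sum_legs !count_map.
lia.
Qed.

End SumPaired.

Lemma paired_bare (P : finType) (i o : seq P) :
  (forall p, count_mem p i + count_mem p o = 2)%N ->
  paired_ends (@joined (bare_wiring i o)) (ends (bare_wiring i o)).
Proof.
move=> two p; rewrite (eq_count (a2 := pred1 p)) => [|q]; last exact: connect_none.
by rewrite count_ends big_pred0 ?two // => -[].
Qed.

Lemma count_mem_enum (T : finType) (x : T) : count_mem x (enum T) = 1%N.
Proof. by rewrite count_uniq_mem ?enum_uniq // mem_enum. Qed.

Lemma count_mem_inj (A B : finType) (h : A -> B) (x : A) :
  injective h -> count_mem (h x) (map h (enum A)) = 1%N.
Proof.
by move=> hI; rewrite count_uniq_mem ?(map_inj_uniq hI) ?enum_uniq // (mem_map hI) mem_enum.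
Qed.

Lemma paired_node l n m :
  paired_ends (@joined (node_wiring l n m)) (ends (node_wiring l n m)).
Proof.
move=> p; rewrite (eq_count (a2 := pred1 p)) => [|q]; last exact: connect_none.
rewrite count_ends (big_pred1 tt) => [|[]] //=; rewrite count_cat.
have none (A B : finType) (h : A -> B) (x : B) : (forall y, h y != x) ->
    count_mem x (map h (enum A)) = 0%N.
  by move=> hx; rewrite count_map (eq_count (a2 := pred0)) ?count_pred0 // => y;
    apply/negbTE/hx.
case: p => p; rewrite count_mem_inj ?none //; by move=> x y [].
Qed.

Lemma paired_wiring D : wf D ->
  paired_ends (@joined (wiring_of D)) (ends (wiring_of D)).
Proof.
elim: D => [n|n m x|n m x|||||D2 IH2 D1 IH1|D1 IH1 D2 IH2].
- by move=> _; apply: paired_bare => p; rewrite !count_mem_enum.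
- by move=> _; apply: paired_node.
- by move=> _; apply: paired_node.
- by move=> _; apply: paired_node.
- by move=> _; apply: paired_bare => -[].
- by move=> _; apply: paired_bare => -[].
- by move=> _; apply: paired_bare => -[].
- case/and3P=> wf1 wf2 /eqP gl; apply: paired_seq; rewrite ?IH1 ?IH2 //.
  + exact: joined_sym.
  + exact: joined_sym.
  + exact: IH1.
  + exact: IH2.
  + by rewrite (size_wiring wf1).2 (size_wiring wf2).1.
- case/andP=> wf1 wf2; apply: paired_par.
  + exact: IH1.
  + exact: IH2.
Qed.

(** * The meta rule *)

(** Some [x] in [A] is paired with a [y] in [B] of the same key; removing both keeps all fibres
    equinumerous, so induction on the size of [A] applies. [u0] is a default value outside [A]. *)
Lemma matching (T U : finType) (K : eqType) (A : {set T}) (B : {set U})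
    (kA : T -> K) (kB : U -> K) (u0 : U) :
  (forall k, #|[set x in A | kA x == k]| = #|[set y in B | kB y == k]|) ->
  exists g : T -> U,
    [/\ {in A &, injective g}, g @: A = B & {in A, forall x, kB (g x) = kA x}].
Proof.
elim: {A}#|A| {-2}A (erefl #|A|) B => [|n IHn] A cA B fib.
  exists (fun=> u0); have A0 := cards0_eq cA; rewrite A0; split=> [x||x]; rewrite ?inE //.
  rewrite imset0; apply/esym/eqP; rewrite -subset0; apply/subsetP => y yB.
  have /eqP := fib (kB y); rewrite A0 eq_sym.
  rewrite (_ : [set x in set0 | _] = set0) ?cards0 ?cards_eq0 => [/eqP/setP/(_ y)|].
    by rewrite !inE yB eqxx.
  by apply/setP => x; rewrite !inE.
have /card_gt0P[x xA] : (0 < #|A|)%N by rewrite cA.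
have /card_gt0P[y] : (0 < #|[set y in B | kB y == kA x]|)%N.
  by rewrite -fib; apply/card_gt0P; exists x; rewrite inE xA eqxx.
rewrite inE => /andP[yB /eqP kE].
have del (V : finType) (C : {set V}) (kC : V -> K) z k :
    [set w in C :\ z | kC w == k] = [set w in C | kC w == k] :\ z.
  by apply/setP => w; rewrite !inE andbA.
have cA' : #|A :\ x| = n by apply: succn_inj; rewrite -cA (cardsD1 x A) xA.
have [|g [gI gB gk]] := IHn _ cA' (B :\ y).
  move=> k; rewrite !del; have := fib k.
  by rewrite (cardsD1 x) (cardsD1 y [set _ in _ | _]) !inE xA yB kE /= => /addnI.
have gD z : z \in A :\ x -> g z \in B :\ y by move=> zA; rewrite -gB imset_f.
exists (fun z => if z == x then y else g z); split.
- move=> z w zA wA; case: (eqVneq z x) => [->|zx]; case: (eqVneq w x) => [->|wx] //.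
  + by move=> yg; have := gD w; rewrite !inE wx wA -yg eqxx => /(_ isT).
  + by move=> yg; have := gD z; rewrite !inE zx zA yg eqxx => /(_ isT).
  + by apply: gI; rewrite !inE ?zx ?wx.
- rewrite -(setD1K xA) imsetU1 eqxx -[RHS](setD1K yB) -gB; congr (_ |: _).
  by apply: eq_in_imset => z; rewrite !inE => /andP[/negbTE->].
- move=> z zA; case: (eqVneq z x) => [->|zx] //.
  by apply: gk; rewrite !inE zx.
Qed.

(** Listing each vertex as often as its multiplicity gives a list of length 0 or 2. The two entries
    [u] and [v] may coincide. *)
Lemma multiplicity_shape (V : finType) (n : V -> nat) :
  (\sum_v n v)%N \in [:: 0%N; 2] ->
  (forall x, n x = 0%N) \/ exists u v, forall x, n x = ((x == u) + (x == v))%N.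
Proof.
pose s := flatten [seq nseq (n v) v | v <- enum V].
have ns x : n x = count_mem x s.
  rewrite count_flatten -map_comp sumnE big_map big_enum /= (bigD1 x) //= count_nseq.
  rewrite /= eqxx mul1n big1 ?addn0 // => v vx.
  by rewrite count_nseq /= (negbTE vx).
have -> : (\sum_v n v)%N = size s.
  rewrite size_flatten /shape -map_comp sumnE big_map big_enum /=.
  by apply: eq_bigr => v _; rewrite size_nseq.
rewrite !inE => /orP[/nilP sE | ].
  by left=> x; rewrite ns sE.
case: s ns => [|u [|v []]] // ns _; right; exists u, v => x.
by rewrite ns /= addn0 !(eq_sym x).
Qed.

Section Wires.
Variable D : diagram.
Let W := wiring_of D.

Definition wire_of (p : point W) : {set point W} := [set q | connect (@joined W) p q].

Lemma connect_joined_sym : connect_sym (@joined W).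
Proof. exact/sym_connect_sym/joined_sym. Qed.

Lemma wire_of_in p : wire_of p \in wires D.
Proof. exact: imset_f. Qed.

Lemma wire_of_eq p q : connect (@joined W) p q -> wire_of p = wire_of q.
Proof.
by move=> pq; apply/setP => x; rewrite !inE (same_connect connect_joined_sym pq).
Qed.

Lemma mem_wire w p : w \in wires D -> (p \in w) = (w == wire_of p).
Proof.
case/imsetP=> q _ ->; rewrite inE; apply/idP/eqP => [|/setP/(_ p)].
  exact: wire_of_eq.
by rewrite !inE connect0.
Qed.

(** Double counting: each leg lies on exactly one wire, namely its [wire_of]. *)
Lemma sum_wire_ends v (P : pred {set point W}) :
  (\sum_(w in wires D | P w) wire_ends w v)%N
  = count (fun p => P (wire_of p)) (vertex_legs v).
Proof.
rewrite /wire_ends; elim: (vertex_legs v) => [|p s IHs] /=.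
  by rewrite big1.
rewrite big_split /= IHs; congr (_ + _)%N.
rewrite (eq_bigr (fun w => nat_of_bool (w == wire_of p))); last first.
  by move=> w /andP[wD _]; rewrite mem_wire.
rewrite -big_mkcondr sum1_card; case: (boolP (P (wire_of p))) => Pp.
  rewrite (eq_card1 (x := wire_of p)) // => w; rewrite !inE unfold_in /=.
  by case: eqP => [->|]; rewrite ?andbF // wire_of_in Pp.
rewrite eq_card0 // => w; rewrite !inE unfold_in /=.
by case: eqP => [->|]; rewrite ?andbF // (negbTE Pp) andbF.
Qed.

Lemma sum_boundary (s : seq (point W)) (a : pred (point W)) :
  (\sum_(j < size s) count a [:: tnth (in_tuple s) j])%N = count a s.
Proof.
rewrite -sum1_count [RHS]big_mkcond big_tnth.
by apply: eq_bigr => j _; rewrite /= addn0; case: (a _).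
Qed.

(** Summed over all vertices, boundary ones included, [wire_ends w] counts the occurrences of one
    connected class in [ends], which is 0 or 2 by [paired_wiring]. *)
Lemma wire_shape w : wf D -> w \in wires D ->
  (forall x, wire_ends w x = 0%N) \/
  exists u v, forall x, wire_ends w x = ((x == u) + (x == v))%N.
Proof.
move=> wfD /imsetP[p _ wE]; apply: multiplicity_shape.
have := paired_wiring wfD p; rewrite count_ends.
rewrite !big_sumType /= /wire_ends /= !sum_boundary.
have wcount L : count (mem w) L = count (connect (@joined (wiring_of D)) p) L.
  by apply: eq_count => q; rewrite wE; apply: in_set.
by rewrite !wcount (eq_bigr (fun v => count (mem w) (legs v))).
Qed.

End Wires.

Definition is_boundary (l : label) : bool :=
  match l with LabelIn _ | LabelOut _ => true | _ => false end.

Lemma node_labelP D (v : node (wiring_of D)) : ~~ is_boundary (node_label v).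
Proof.
elim: D v => [n|n m x|n m x|||||D2 IH2 D1 IH1|D1 IH1 D2 IH2] //= [] v;
  by [apply: IH1 | apply: IH2].
Qed.

Section MetaRule.
Variable R : comNzRingType.
Variable weight : label -> nat -> nat -> R.

(** Inputs and outputs become ordinary vertices whose weight enforces the boundary strings: such a
    vertex has a single leg, so [n1] is the bit on it. *)
Definition boundary_weight (a b : seq bool) (l : label) (n0 n1 : nat) : R :=
  match l with
  | LabelIn j => (n1 == nth false a j)%:R
  | LabelOut j => (n1 == nth false b j)%:R
  | _ => weight l n0 n1
  end.

(** A labelling is encoded by the set [A] of wires that carry the bit 1. The sum then depends on
    vertex labels and end counts alone; a closed loop has no end and merely doubles it. *)
Definition wire_sum (D : diagram) (a b : seq bool) : R :=
  \sum_(A : {set {set point (wiring_of D)}} | A \subset wires D)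
    \prod_(v : vertex D)
      boundary_weight a b (vertex_label v)
        (\sum_(w in wires D | w \notin A) wire_ends w v)
        (\sum_(w in wires D | w \in A) wire_ends w v).

Lemma prod_boundary (P : Type) (phi : P -> bool) (s : seq P) (c : seq bool) :
  size c = size s ->
  \prod_(j < size s) (count phi [:: tnth (in_tuple s) j] == nth false c j)%:R
  = (map phi s == c)%:R :> R.
Proof.
move=> sc; case: eqP => [<-|ne].
  rewrite big1 // => j _ /=; rewrite addn0 (tnth_nth (tnth (in_tuple s) j)) /=.
  by rewrite (nth_map (tnth (in_tuple s) j)) // eqxx.
have [j neq] : exists j : 'I_(size s), phi (tnth (in_tuple s) j) != nth false c j.
  apply/existsP; apply: contraT => /existsPn eq; case: ne.
  apply: (@eq_from_nth _ false) => [|i]; rewrite size_map ?sc // => lt_i.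
  have := eq (Ordinal lt_i); rewrite negbK => /eqP <-.
  have x0 := tnth (in_tuple s) (Ordinal lt_i).
  by rewrite (nth_map x0) // (tnth_nth x0).
rewrite (bigD1 j) //= addn0; move: neq; case: (phi _); case: (nth _ _ _) => //= _;
by rewrite mul0r.
Qed.

Lemma state_sum_wire_sum D a b : wf D -> size a = dom D -> size b = cod D ->
  state_sum weight (wiring_of D) a b = wire_sum D a b.
Proof.
move=> wfD sa sb; have [si so] := size_wiring wfD.
pose F (phi : {ffun point (wiring_of D) -> bool}) := \prod_(v : vertex D)
  boundary_weight a b (vertex_label v)
    (count (fun p => ~~ phi p) (vertex_legs v)) (count phi (vertex_legs v)).
(* The conditions on the boundary strings are turned into 0-or-1 factors at the input and output
   vertices. *)
transitivity (\sum_(phi : {ffun point (wiring_of D) -> bool} | respects phi) F phi).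
  rewrite /state_sum big_mkcondr; apply: eq_bigr => phi _.
  rewrite /F !big_sumType /= !prod_boundary ?si ?so //.
  rewrite [X in _ = X * _](eq_bigr (node_value weight phi)); last first.
    move=> v _; rewrite /node_value /boundary_weight.
    by have := node_labelP v; case: (node_label v).
  case: (_ == a); case: (_ == b); rewrite /= ?mulr1 ?mulr0 //.
pose phi_of (A : {set {set point (wiring_of D)}}) : {ffun point (wiring_of D) -> bool} :=
  [ffun p => wire_of p \in A].
(* Labellings constant along wires correspond to subsets of [wires D]: a subset yields the labelling
   by membership of [wire_of p], and a labelling yields the set of wires of its 1-pieces. *)
rewrite (reindex_onto phi_of (fun phi : {ffun point (wiring_of D) -> bool} =>
  [set wire_of p | p in [set p | phi p]])).
  rewrite /wire_sum; apply: eq_big => [A | A _].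
    have -> : respects (phi_of A).
      apply/forallP => p; apply/forallP => q; apply/implyP => pq.
      by rewrite !ffunE (wire_of_eq (connect1 pq)).
    rewrite /=; apply/eqP/subsetP => [<- w /imsetP[p _ ->] | AD]; first exact: wire_of_in.
    apply/setP => w; apply/imsetP/idP => [[p]|wA].
      by rewrite inE ffunE => ? ->.
    have /imsetP[p _ wE] := AD _ wA; exists p => //.
    by rewrite inE ffunE /wire_of -wE.
  apply: eq_bigr => v _; rewrite !sum_wire_ends; congr (boundary_weight _ _ _ _ _);
  by apply: eq_count => p; rewrite ffunE.
move=> phi /forallP resp; apply/ffunP => p; rewrite ffunE.
apply/imsetP/idP => [[q]|php]; last by exists p; rewrite ?inE.
rewrite inE => phq /setP/(_ q); rewrite !inE connect0 => pq.
suff -> : phi p = phi q by [].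
apply/eqP; move: pq; apply: (@connect_min _ _ (fun p q => phi p == phi q)) =>
  [z|u v z uv /eqP <-].
  by [].
by have /forallP/(_ v)/implyP := resp u; apply.
Qed.

(** Wires are matched by the key recording how many ends they have at each vertex, transported along
    [f]. For a key of two ends the number of wires is an edge count, for the zero key it is the
    number of loops, and by [wire_shape] no other key occurs. *)
Lemma wire_matching D1 D2 (f : vertex D1 -> vertex D2) :
  wf D1 -> wf D2 -> bijective f ->
  (forall u v, edges (f u) (f v) = edges u v) -> loops D1 = loops D2 ->
  exists g : {set point (wiring_of D1)} -> {set point (wiring_of D2)},
    [/\ {in wires D1 &, injective g}, g @: wires D1 = wires D2
      & {in wires D1, forall w x, wire_ends (g w) (f x) = wire_ends w x}].
Proof.
move=> wf1 wf2 [f' fK f'K] fe lp.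
pose k1 (w : {set point (wiring_of D1)}) := [ffun x : vertex D1 => wire_ends w x].
pose k2 (w : {set point (wiring_of D2)}) := [ffun x : vertex D1 => wire_ends w (f x)].
suff fib k : #|[set w in wires D1 | k1 w == k]| = #|[set w in wires D2 | k2 w == k]|.
  have [g [gI gW gk]] := matching set0 fib; exists g; split=> // w wD x.
  by have /ffunP/(_ x) := gk w wD; rewrite !ffunE.
have E1 (n : vertex D1 -> nat) : k =1 n ->
    [set w in wires D1 | k1 w == k] = [set w in wires D1 | [forall x, wire_ends w x == n x]].
  move=> kn; apply/setP => w; rewrite !inE; congr (_ && _); apply/eqP/forallP => [kE x|wn].
    by rewrite -kn -kE ffunE.
  by apply/ffunP => x; rewrite ffunE kn; apply/eqP.
have E2 (n : vertex D2 -> nat) : (forall x, k x = n (f x)) ->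
    [set w in wires D2 | k2 w == k] = [set w in wires D2 | [forall x, wire_ends w x == n x]].
  move=> kn; apply/setP => w; rewrite !inE; congr (_ && _); apply/eqP/forallP => [kE x|wn].
    by rewrite -(f'K x) -kn -kE ffunE.
  by apply/ffunP => x; rewrite ffunE kn; apply/eqP.
have [/existsP[u /existsP[v /forallP kuv]] | notuv] :=
  boolP [exists u, exists v, forall x, k x == ((x == u) + (x == v))%N].
  have kE x : k x = ((x == u) + (x == v))%N by apply/eqP.
  rewrite (E1 _ kE) (E2 (fun x => (x == f u) + (x == f v))%N); first by rewrite -[LHS]fe.
  by move=> x; rewrite kE !(can_eq fK).
have [/forallP k0 | not0] := boolP [forall x, k x == 0%N].
  rewrite (E1 (fun=> 0%N)) ?(E2 (fun=> 0%N)) //; by move=> x; apply/eqP.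
(* The key [k] is now neither zero nor made of two ends, so both fibres are empty. *)
have -> : [set w in wires D1 | k1 w == k] = set0.
  apply/setP => w; rewrite !inE; apply/negbTE/negP => /andP[wD /eqP kE].
  case: (wire_shape wf1 wD) => [w0|[u [v wuv]]].
    by case/negP: not0; apply/forallP => x; rewrite -kE ffunE w0.
  case/negP: notuv; apply/existsP; exists u; apply/existsP; exists v.
  by apply/forallP => x; rewrite -kE ffunE wuv.
have -> : [set w in wires D2 | k2 w == k] = set0.
  apply/setP => w; rewrite !inE; apply/negbTE/negP => /andP[wD /eqP kE].
  case: (wire_shape wf2 wD) => [w0|[u [v wuv]]].
    by case/negP: not0; apply/forallP => x; rewrite -kE ffunE w0.
  case/negP: notuv; apply/existsP; exists (f' u); apply/existsP; exists (f' v).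
  by apply/forallP => x; rewrite -kE ffunE wuv !(can2_eq fK f'K).
by rewrite !cards0.
Qed.

Lemma wire_sum_connectivity D1 D2 a b : wf D1 -> wf D2 ->
  same_connectivity D1 D2 -> wire_sum D1 a b = wire_sum D2 a b.
Proof.
move=> wf1 wf2 [[f [fB fl fe]] lp].
have [g [gI gW gk]] := wire_matching wf1 wf2 fB fe lp.
have memg (A : {set {set point (wiring_of D1)}}) w :
    A \subset wires D1 -> w \in wires D1 -> (g w \in g @: A) = (w \in A).
  move=> /subsetP AD wD; apply/imsetP/idP => [[w' w'A /gI ->]|wA] //; first exact: AD.
  by exists w.
(* Subsets of wires are transported along [g], and below the vertices along [f]; every factor of the
   product is preserved. *)
rewrite /wire_sum [RHS](reindex_onto
  (fun A : {set {set point (wiring_of D1)}} => g @: A)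
  (fun B => [set w in wires D1 | g w \in B])); last first.
  move=> B; rewrite -gW => /subsetP BD; apply/setP => y; apply/imsetP/idP.
    by case=> w; rewrite inE => /andP[_ ?] ->.
  move=> yB; have /imsetP[w wD yE] := BD _ yB.
  by exists w => //; rewrite inE wD -yE.
apply: eq_big => [A | A AD].
  apply/idP/andP => [AD | [_ /eqP <-]].
    rewrite -gW imsetS //; split=> //; apply/eqP/setP => w; rewrite inE.
    case wD: (w \in wires D1); first by rewrite memg.
    by apply/esym/negbTE; apply: contraFN wD; apply: (subsetP AD).
  by apply/subsetP => w; rewrite inE => /andP[].
rewrite [RHS](reindex f) /=; last exact: onW_bij.
apply: eq_bigr => v _; rewrite fl -gW; congr (boundary_weight _ _ _ _ _).
all: rewrite [RHS]big_imset_cond //=.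
all: apply: eq_big => [w|w /andP[wD _]]; last by rewrite gk.
all: by case wD: (w \in wires D1); rewrite //= memg.
Qed.

Lemma meta_sound D1 D2 : parallel D1 D2 -> same_connectivity D1 D2 ->
  same_interp weight D1 D2.
Proof.
move=> [wf1 wf2 dE cE] conn a b sa sb.
rewrite -!state_sum_interp ?state_sum_wire_sum -?dE -?cE //.
exact: wire_sum_connectivity.
Qed.

End MetaRule.

(** * The twisted qubit model *)

Section Model.
Variables (F : fieldType) (h c u0 u1 : F).
Hypotheses (u0_neq0 : u0 != 0) (u1_neq0 : u1 != 0) (hc : h * c + h * c = 1).

Definition phase (y : bool) (x : angle) : F := (if y then u1 else u0) ^ x.

(** Here [u0] and [u1] are the scalars [zeta] and [zeta i], and [c] is the factor in the inverse of
    [H], which is [c] times the matrix [[1, 1], [1, -1]] by [hc]. A legless green spider satisfies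
    both tests and is the sum of the two phases. The sign in [LabelH] occurs when both legs carry
    1. *)
Definition model (l : label) (n0 n1 : nat) : F :=
  match l with
  | LabelZ x => (n1 == 0)%:R * phase false x + (n0 == 0)%:R * phase true x
  | LabelX x => c ^+ (n0 + n1) * (phase false x + (-1) ^+ n1 * phase true x)
  | LabelH => if n1 == 2 then - h else h
  | _ => 0
  end.

Lemma phaseD y x x' : phase y (add_angle x x') = phase y x * phase y x'.
Proof. by rewrite /phase expfzDr //; case: y. Qed.

Lemma spiderZE x s : spider model (LabelZ x) s
  = (all negb s)%:R * phase false x + (all id s)%:R * phase true x.
Proof.
rewrite /spider /= !all_count -(count_predC negb s) /=.
have -> : count (predC negb) s = count id s by apply: eq_count => y /=; rewrite negbK.
congr (_%:R * _ + _%:R * _).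
  by rewrite -[X in X == (_ + _)%N]addn0 eqn_add2l eq_sym.
by rewrite -[X in X == (_ + _)%N]add0n eqn_add2r eq_sym.
Qed.

Lemma bit_sum_all (n : nat) :
  bit_sum n (fun s => (all negb s)%:R : F) = 1 /\
  bit_sum n (fun s => (all id s)%:R : F) = 1.
Proof.
have zero m : bit_sum m (fun=> 0 * 0 : F) = 0 by rewrite bit_sum_mull mul0r.
rewrite mulr0 in zero.
by elim: n => [|n [IH0 IH1]] //=; rewrite zero IH0 IH1 addr0 add0r.
Qed.

(** A shared leg forces both spiders to carry the same constant bit, so the cross terms vanish and
    the phases multiply. Without a shared leg the cross terms would survive. *)
Lemma spiderZ_fuse k x y s t : (0 < k)%N ->
  bit_sum k (fun u => spider model (LabelZ x) (s ++ u) * spider model (LabelZ y) (u ++ t))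
  = spider model (LabelZ (add_angle x y)) (s ++ t).
Proof.
move=> k_gt0; have [sum0 sum1] := bit_sum_all k.
rewrite spiderZE !phaseD !all_cat.
rewrite (eq_bit_sum (g := fun u =>
    (all negb u)%:R * ((all negb s && all negb t)%:R * (phase false x * phase false y))
  + (all id u)%:R * ((all id s && all id t)%:R * (phase true x * phase true y)))).
  by rewrite bit_sumD !bit_sum_mulr sum0 sum1 !mul1r.
move=> u su; rewrite !spiderZE !all_cat.
case: u su => [su|v u _]; first by rewrite -su in k_gt0.
case: v => /=; rewrite ?andbF /=;
  rewrite -!mulnb !natrM.
- case: (all id u); rewrite /= ?mulr0n ?mulr1n; ring.
- case: (all negb u); rewrite /= ?mulr0n ?mulr1n; ring.
Qed.

Lemma S1_sound a b e d k (x y : angle) : (0 < k)%N ->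
  same_interp model
    (Comp (Tens (Id b) (RZ (k + e) d y)) (Tens (RZ a (b + k) x) (Id e)))
    (RZ (a + e) (b + d) (add_angle x y)).
Proof.
move=> k_gt0 A B /= sA sB.
set A1 := take a A; set A2 := drop a A; set B1 := take b B; set B2 := drop b B.
have sB1 : size B1 = b by rewrite size_take_min sB; apply/minn_idPl; rewrite leq_addr.
have sA2 : size A2 = e by rewrite size_drop sA addKn.
have perm_spider l s t : perm_eq s t -> spider model l s = spider model l t.
  by move=> /permP st; rewrite /spider !st.
(* The legs of the fused spider are regrouped by the factor they come from. The strings [s1] and
   [s3] on the identity wires are then removed by deltas, leaving the [k] shared legs. *)
rewrite (perm_spider _ (A ++ B) ((A1 ++ B1) ++ (A2 ++ B2))); last first.
  by rewrite -{1}(cat_take_drop a A) -{1}(cat_take_drop b B) -!catA perm_cat2l perm_catCA.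
rewrite -(spiderZ_fuse _ _ _ _ k_gt0) !bit_sum_cat.
rewrite (eq_bit_sum (g := fun s1 => (B1 == s1)%:R * bit_sum k (fun s2 =>
  spider model (LabelZ x) ((A1 ++ s1) ++ s2)
  * spider model (LabelZ y) (s2 ++ A2 ++ B2)))).
  by rewrite -{1}sB1 bit_sum_delta.
move=> s1 ss1; rewrite -bit_sum_mull; apply: eq_bit_sum => s2 ss2.
rewrite (eq_bit_sum (g := fun s3 => (A2 == s3)%:R * ((B1 == s1)%:R *
  (spider model (LabelZ x) ((A1 ++ s1) ++ s2)
   * spider model (LabelZ y) (s2 ++ s3 ++ B2))))).
  by rewrite -{1}sA2 bit_sum_delta.
move=> s3 ss3.
have ss : size (s1 ++ s2) = (b + k)%N by rewrite size_cat ss1 ss2.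
rewrite (take_size_cat _ ss) (drop_size_cat _ ss) -(catA s1).
rewrite (take_size_cat _ ss1) (drop_size_cat _ ss1) (eq_sym s1) !catA; ring.
Qed.

(** The entry between the constant string of [y] and [s] in the tensor power of the inverse of
    [H]. *)
Definition wave (y : bool) (s : seq bool) : F :=
  c ^+ size s * (-1) ^+ (y * count id s)%N.

Lemma wave_cat y s t : wave y (s ++ t) = wave y s * wave y t.
Proof. by rewrite /wave size_cat count_cat mulnDr !exprD mulrACA. Qed.

Lemma spiderXE x s : spider model (LabelX x) s
  = wave false s * phase false x + wave true s * phase true x.
Proof.
rewrite /spider /wave /= mul0n mul1n mulr1 mulrDr mulrA.
have -> : (count negb s + count id s)%N = size s.
  by rewrite -(count_predC negb s); congr (_ + _)%N; apply: eq_count => y /=; rewrite negbK.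
by [].
Qed.

Lemma tens_pow_shape n :
  [/\ wf (tens_pow H n), dom (tens_pow H n) = n & cod (tens_pow H n) = n].
Proof. by elim: n => [|n [wfn dn cn]] //=; rewrite dn cn. Qed.

Lemma H_column x y :
  spider model LabelH [:: x; false] * wave y [:: false]
  + spider model LabelH [:: x; true] * wave y [:: true] = (x == y)%:R.
Proof.
rewrite -hc /spider /wave; case: x; case: y; rewrite /= ?(expr0, expr1); ring.
Qed.

Lemma H_row x y :
  wave y [:: false] * spider model LabelH [:: false; x]
  + wave y [:: true] * spider model LabelH [:: true; x] = (x == y)%:R.
Proof.
rewrite -hc /spider /wave; case: x; case: y; rewrite /= ?(expr0, expr1); ring.
Qed.

(** Leg by leg, each [H] cancels the inverse of [H] contained in the wave, which leaves the
    indicator of the constant string [y]. *)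
Lemma H_pow_column y n a : size a = n ->
  bit_sum n (fun s => interp model (tens_pow H n) a s * wave y s)
  = (all (pred1 y) a)%:R.
Proof.
elim: n a => [|n IHn] [|x a] //= sa.
  by rewrite /wave /= muln0 !mul1r.
case: sa => sa; rewrite take0 drop0 -mulnb natrM -(IHn a sa) -H_column mulrDl.
congr (_ + _); rewrite -bit_sum_mull; apply: eq_bit_sum => s _;
  by rewrite take0 drop0 (wave_cat y [:: _] s) mulrACA.
Qed.

Lemma H_pow_row y n a : size a = n ->
  bit_sum n (fun s => wave y s * interp model (tens_pow H n) s a)
  = (all (pred1 y) a)%:R.
Proof.
elim: n a => [|n IHn] [|x a] //= sa.
  by rewrite /wave /= muln0 !mul1r.
case: sa => sa; rewrite take0 drop0 -mulnb natrM -(IHn a sa) -H_row mulrDl.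
congr (_ + _); rewrite -bit_sum_mull; apply: eq_bit_sum => s _;
  by rewrite take0 drop0 (wave_cat y [:: _] s) mulrACA.
Qed.

(** By [spiderXE] a red spider is a combination of the two waves, each a product over the legs; the
    [H] powers turn wave [y] back into the indicator of the constant string [y]. *)
Lemma HH_sound n m x :
  same_interp model (Comp (tens_pow H m) (Comp (RX n m x) (tens_pow H n))) (RZ n m x).
Proof.
have [_ dn cn] := tens_pow_shape n; have [_ dm cm] := tens_pow_shape m.
move=> a b /=; rewrite dn cm cn => sa sb.
rewrite spiderZE !all_cat -!mulnb !natrM.
have allE (y : bool) (s : seq bool) : all (pred1 y) s = all (if y then id else negb) s.
  by apply: eq_all => z; case: y; case: z.
rewrite (eq_bit_sum (g := fun v =>
    ((all negb a)%:R * phase false x) * (wave false v * interp model (tens_pow H m) v b)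
  + ((all id a)%:R * phase true x) * (wave true v * interp model (tens_pow H m) v b))).
  rewrite bit_sumD !bit_sum_mull !H_pow_row // !allE; ring.
move=> v _; rewrite (eq_bit_sum (g := fun d =>
    (wave false v * phase false x) * (interp model (tens_pow H n) a d * wave false d)
  + (wave true v * phase true x) * (interp model (tens_pow H n) a d * wave true d))).
  rewrite bit_sumD !bit_sum_mull !H_pow_column // !allE; ring.
by move=> d _; rewrite spiderXE !wave_cat; ring.
Qed.

End Model.

(** * Verification of the finite rules over the field with 73 elements *)

Section Check.
Variable R : comNzRingType.
Variable weight : label -> nat -> nat -> R.

Fixpoint bit_strings (n : nat) : seq (seq bool) :=
  if n is n'.+1 then
    map (cons false) (bit_strings n') ++ map (cons true) (bit_strings n')
  else [:: [::]].

Lemma mem_bit_strings s : s \in bit_strings (size s).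
Proof. by elim: s => [|[] s IHs] //=; rewrite mem_cat map_f ?orbT. Qed.

Lemma same_interp_check D1 D2 :
  all (fun a => all (fun b => interp weight D1 a b == interp weight D2 a b)
    (bit_strings (cod D1))) (bit_strings (dom D1)) ->
  same_interp weight D1 D2.
Proof.
move=> /allP checked a b sa sb.
have aP : a \in bit_strings (dom D1) by rewrite -sa mem_bit_strings.
have bP : b \in bit_strings (cod D1) by rewrite -sb mem_bit_strings.
by have /allP/(_ b bP)/eqP := checked a aP.
Qed.

End Check.

(* In 'F_73, [h = 2] gives [s = 2 h^2 = 8] with [8^3 = 1], [c = 55] is the
   inverse of [2 h], [zeta = s^2 = 64], [i = 27] and [zeta i = 49]. *)
Definition ZX_model := @model ('F_73 : fieldType) 2 55 64 49.

Lemma ZX_model_u0 : (64 : 'F_73) != 0.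
Proof. by vm_compute. Qed.

Lemma ZX_model_u1 : (49 : 'F_73) != 0.
Proof. by vm_compute. Qed.

Lemma ZX_model_hc : 2 * 55 + 2 * 55 = 1 :> 'F_73.
Proof. by apply/eqP; vm_compute. Qed.

Lemma rules_sound r D1 D2 : without (without ZX_simp B2) S3R r ->
  rule_eq r D1 D2 -> parallel D1 D2 /\ same_interp ZX_model D1 D2.
Proof.
move=> [[_ nB2] nS3R] rD; case: rD nB2 nS3R => {r D1 D2}.
- by move=> D1 D2 par conn _ _; split; [|apply: meta_sound].
- move=> a b e d k x y k_gt0 _ _; split;
    last exact: S1_sound ZX_model_u0 ZX_model_u1 _ _ _ _ _ _ _ k_gt0.
  by split; rewrite /= ?addnA ?eqxx.
- by move=> _ _; split; [|apply: same_interp_check; vm_compute].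
- by [].
- by move=> _ _; split; [|apply: same_interp_check; vm_compute].
- by [].
- by move=> _ _; split; [|apply: same_interp_check; vm_compute].
- move=> n m x _ _; split; last exact: HH_sound ZX_model_hc _ _ _.
  have [wn dn cn] := tens_pow_shape n; have [wm dm cm] := tens_pow_shape m.
  by split; rewrite /= ?wn ?wm ?dn ?cn ?dm ?cm ?eqxx.
- by move=> _ _; split; [|apply: same_interp_check; vm_compute].
- by move=> _ _; split; [|apply: same_interp_check; vm_compute].
Qed.

Theorem lemma3p8 :
  ~ derives (without (without ZX_simp B2) S3R) B2_lhs B2_rhs /\
  ~ derives (without (without ZX_simp B2) S3R) S3R_lhs S3R_rhs.
Proof.
split=> /(derives_sound rules_sound)[_].
(* At this entry the left side is [2 (2 c^3)^2 = 8 c^6] and the right side is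
   [(2 c)(2 c^3) = 4 c^4]; their ratio [2 c^2] is the inverse of [s], namely 64. *)
- by move=> /(_ [:: false; false] [:: false; false] erefl erefl)/eqP; vm_compute.
(* Here the green side is 1 and the red side is [2 c^2 = 64]. *)
- by move=> /(_ [::] [:: false; false] erefl erefl)/eqP; vm_compute.
Qed.
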